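(* Let $\mathbb F$ be a division ring. (1) The minimal polynomials $\mathfrak P_{A,\mathbf v}$ and $\mathfrak P_{A',\mathbf v'}$ of controllable pairs $(A,\mathbf v)$ and $(A',\mathbf v')$ over $\mathbb F$ are similar if and only if $A\sim A'$. (2) The minimal polynomials $\mathfrak P_{\mathbf u,A}$ and $\mathfrak P_{\mathbf u',A'}$ of observable pairs $(\mathbf u,A)$ and $(\mathbf u',A')$ over $\mathbb F$ are similar if and only if $A\sim A'$.
   Context: $\mathbb F[z]$ is the ring of polynomials over $\mathbb F$ in a formal variable $z$ commuting with the coefficients. $A\sim A'$ means $A'=TAT^{-1}$ for some invertible matrix $T$ over $\mathbb F$ (same sizes). For $A\in\mathbb F^{n\times n}$, $\mathbf v\in\mathbb F^{n\times1}$, $\mathbf u\in\mathbb F^{1\times n}$: $(A,\mathbf v)$ is controllable if $[\mathbf v\ A\mathbf v\ \cdots\ A^{n-1}\mathbf v]$ is invertible; $(\mathbf u,A)$ is observable if the matrix with rows $\mathbf u,\mathbf uA,\dots,\mathbf uA^{n-1}$ is invertible. $\mathfrak P_{A,\mathbf v}$ is the monic generator of the right ideal $\{p=\sum p_jz^j\in\mathbb F[z]:\sum_jA^j\mathbf vp_j=0\}$; $\mathfrak P_{\mathbf u,A}$ is the monic generator of the left ideal $\{p=\sum p_jz^j\in\mathbb F[z]:\sum_jp_j\mathbf uA^j=0\}$. For monic $p(z)=z^n+\sum_{k=0}^{n-1}p_kz^k$, the left companion matrix is $C_\ell(p)=[\mathbf e_2\ \cdots\ \mathbf e_n\ \ -\mathbf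 p]$, $\mathbf p=[p_0\ \cdots\ p_{n-1}]^\top$, where $\mathbf e_j$ is the $j$-th column of $\mathbf I_n$. Monic polynomials $f,g\in\mathbb F[z]$ are called similar, $f\approx g$, if $C_\ell(f)\sim C_\ell(g)$. *)

(* Defs.v *)
From HB Require Import structures.
From mathcomp Require Import all_boot all_order all_algebra.
From mathcomp Require Import boolp classical_sets.

Set Implicit Arguments.
Unset Strict Implicit.
Unset Printing Implicit Defensive.

Import GRing.Theory.
Local Open Scope ring_scope.

(* Units of a unitRingType are the two-sided invertible elements, and 1 != 0;
   commutativity is not assumed. *)
Definition division_ring (F : unitRingType) : Prop :=
  forall x : F, x != 0 -> x \is a GRing.unit.

Section Definitions.

Variable F : unitRingType.

(* The library's unitmx relies on determinants, hence on commutativity. *)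
Definition mx_inverses n (T S : 'M[F]_n) : Prop :=
  T *m S = 1%:M /\ S *m T = 1%:M.

Definition mx_invertible n (T : 'M[F]_n) : Prop :=
  exists S : 'M[F]_n, mx_inverses T S.

(* The sizes are allowed to differ syntactically, because the size of a
   companion matrix is computed from its polynomial; similarity includes the
   equality of the sizes. *)
Definition mx_similar m n (A : 'M[F]_m) (B : 'M[F]_n) : Prop :=
  exists (eq_mn : m = n) (T S : 'M[F]_n),
    mx_inverses T S /\ B = T *m castmx (eq_mn, eq_mn) A *m S.

Definition controllable n (A : 'M[F]_n) (v : 'cV[F]_n) : Prop :=
  mx_invertible (\matrix_(i < n, j < n) (A ^+ j *m v) i ord0).

Definition observable n (u : 'rV[F]_n) (A : 'M[F]_n) : Prop :=
  mx_invertible (\matrix_(i < n, j < n) (u *m A ^+ i) ord0 j).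

(* The library only has left scaling; the right multiple of a column w by the
   scalar a is w *m a%:M with a%:M of size 1. *)
Definition right_annihilator n (A : 'M[F]_n) (v : 'cV[F]_n) : set {poly F} :=
  [set p | \sum_(j < size p) A ^+ j *m v *m (p`_j)%:M = 0]%classic.

Definition left_annihilator n (u : 'rV[F]_n) (A : 'M[F]_n) : set {poly F} :=
  [set p | \sum_(j < size p) p`_j *: (u *m A ^+ j) = 0]%classic.

Definition monic_right_generator (I : set {poly F}) (p : {poly F}) : Prop :=
  p \is monic /\ forall q : {poly F}, I q <-> exists r : {poly F}, q = p * r.

Definition monic_left_generator (I : set {poly F}) (p : {poly F}) : Prop :=
  p \is monic /\ forall q : {poly F}, I q <-> exists r : {poly F}, q = r * p.

(* Over a division ring these ideals are nonzero, and their monic generator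
   exists and is unique; the default value 0 is not reached. *)
Definition minpoly_col n (A : 'M[F]_n) (v : 'cV[F]_n) : {poly F} :=
  xget 0 (monic_right_generator (right_annihilator A v)).

Definition minpoly_row n (u : 'rV[F]_n) (A : 'M[F]_n) : {poly F} :=
  xget 0 (monic_left_generator (left_annihilator u A)).

(* This is the transpose of the library's companionmx. *)
Definition left_companionmx (p : {poly F}) : 'M[F]_((size p).-1) :=
  \matrix_(i < (size p).-1, j < (size p).-1)
    if (j == (size p).-2 :> nat) then - p`_i else (i == j.+1 :> nat)%:R.

Definition poly_similar (f g : {poly F}) : Prop :=
  [/\ f \is monic, g \is monic &
      mx_similar (left_companionmx f) (left_companionmx g)].

End Definitions.

(* Main.v *)
(* Writing V for the controllability matrix, A V = V C where C is the left
   companion matrix of the monic polynomial p of degree n whose lower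
   coefficients are read off - V^-1 A^n v.  As V is invertible, the annihilator
   of v contains no nonzero polynomial of degree below n, so its monic generator
   has degree n and A is similar to its left companion matrix.  Dually, an
   observable A is similar to the right companion matrix of its minimal
   polynomial; the symmetrizer, that is the triangular Hankel matrix of the
   coefficients, conjugates the right companion matrix into the left one, also
   over noncommutative coefficients. *)
Require Import Defs.
From HB Require Import structures.
From mathcomp Require Import all_boot all_order all_algebra.
From mathcomp Require Import zify.
From mathcomp Require classical_sets.

Set Implicit Arguments.
Unset Strict Implicit.
Unset Printing Implicit Defensive.

Import GRing.Theory.
Local Open Scope ring_scope.

(** * Similarity as an equivalence, and inverses of unitriangular matrices *)

Section Similarity.

Variable F : unitRingType.

Lemma mx_similarP n (A B T S : 'M[F]_n) :
  mx_inverses T S -> T *m A = B *m T -> mx_similar A B.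
Proof.
move=> [TS ST] TA; exists erefl, T, S; split=> //.
by rewrite castmx_id TA -mulmxA TS mulmx1.
Qed.

Lemma mx_similar_sym m n (A : 'M[F]_m) (B : 'M[F]_n) :
  mx_similar A B -> mx_similar B A.
Proof.
case=> e; case: n / e B => B [T [S [[TS ST] ->]]]; rewrite castmx_id.
by apply: (@mx_similarP _ _ _ S T); rewrite // !mulmxA ST mul1mx.
Qed.

Lemma mx_similar_trans m n p (A : 'M[F]_m) (B : 'M[F]_n) (C : 'M[F]_p) :
  mx_similar A B -> mx_similar B C -> mx_similar A C.
Proof.
case=> e; case: n / e B => B [T [S [[TS ST] ->]]]; rewrite castmx_id.
case=> e; case: p / e C => C [T' [S' [[TS' ST'] ->]]]; rewrite castmx_id.
apply: (@mx_similarP _ _ _ (T' *m T) (S *m S')).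
  split; first by rewrite mulmxA -(mulmxA T') TS mulmx1.
  by rewrite mulmxA -(mulmxA S) ST' mulmx1.
by rewrite -!mulmxA (mulmxA S') ST' mul1mx ST mulmx1.
Qed.

(** Here T = 1 - N with N strictly upper triangular, hence nilpotent, so the finite geometric sum of
    powers of N inverts T without any determinant. *)
Lemma unitriangular_invertible n (T : 'M[F]_n) :
  (forall i j : 'I_n, (j <= i)%N -> T i j = (i == j)%:R) -> mx_invertible T.
Proof.
move=> Ttri; pose N := 1%:M - T.
(* Each further factor N pushes the support one superdiagonal up. *)
have Npow k (i j : 'I_n) : (j < i + k)%N -> (N ^+ k) i j = 0.
  elim: k i j => [|k IHk] i j lt_j.
    by rewrite expr0 mxE; case: eqP lt_j => // ->; rewrite addn0 ltnn.
  rewrite exprS mxE big1 // => l _.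
  case: (leqP l i) => [le_li|lt_il]; first by rewrite !mxE Ttri // subrr mul0r.
  by rewrite IHk ?mulr0 // (leq_trans lt_j) // addnS -addSn leq_add2r.
have Nn0 : N ^+ n = 0.
  by apply/matrixP=> i j; rewrite Npow ?mxE // ltn_addl.
have TE : T = - (N - 1) by rewrite /N opprB subKr.
(* [subrX1] gives the inverse on one side only; this commutation gives the other. *)
have cN : GRing.comm (N - 1) (\sum_(i < n) N ^+ i).
  apply: commr_sum => i _; apply: commrX; apply/commr_sym.
  by apply: commrB; [apply: commr_refl | apply: commr1].
exists (\sum_(i < n) N ^+ i).
by split; rewrite mulmxE TE ?mulrN ?mulNr -?cN -subrX1 Nn0 sub0r opprK.
Qed.

End Similarity.

(** * Conjugating the right companion matrix into the left one *)

Section Companion.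

Variable F : unitRingType.

Definition right_companionmx (p : {poly F}) : 'M[F]_((size p).-1) :=
  \matrix_(i < (size p).-1, j < (size p).-1)
    if (i == (size p).-2 :> nat) then - p`_j else (j == i.+1 :> nat)%:R.

(** A Hankel matrix: for monic [p] of degree n the antidiagonal i + j = n - 1 carries the leading
    coefficient 1, and the entries beyond it are 0. *)
Definition symmetrizer (p : {poly F}) : 'M[F]_((size p).-1) :=
  \matrix_(i, j) p`_(i + j).+1.

(** Reversing the columns moves the antidiagonal of ones to the diagonal and yields a unitriangular
    matrix; reversing the rows of its inverse undoes this. *)
Lemma symmetrizer_invertible (p : {poly F}) :
  p \is monic -> mx_invertible (symmetrizer p).
Proof.
move=> p_mon; have p_gt0 : (0 < size p)%N by rewrite size_poly_gt0 monic_neq0.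
pose T := \matrix_(i, j) symmetrizer p i (rev_ord j).
have [i j le_ji|S [TS ST]] := @unitriangular_invertible _ _ T.
  have above s a b : (b < s.-1 -> b <= a -> a != b ->
      s <= (a + (s.-1 - b.+1)).+1)%N by lia.
  rewrite !mxE /=; case: eqP => [->|/eqP ne_ij].
    by rewrite -addnS subnSK // subnKC 1?ltnW //; exact/monicP.
  by rewrite nth_default //; apply: above.
exists (\matrix_(i, j) S (rev_ord i) j); split; apply/matrixP=> i j.
  rewrite -TS !mxE (reindex_inj rev_ord_inj) /=.
  by apply: eq_bigr => k _; rewrite !mxE rev_ordK.
have /matrixP/(_ (rev_ord i) (rev_ord j)) := ST.
rewrite !mxE (inj_eq rev_ord_inj) => <-.
by apply: eq_bigr => k _; rewrite !mxE rev_ordK.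
Qed.

(** This is row [i] of a left companion matrix applied to [h]. Its shift entry sits at k = i - 1,
    which is never the last index as i < n, so the two contributions do not overlap. *)
Lemma sum_shift_row n i (a : F) (h : nat -> F) : (i < n)%N ->
  \sum_(k < n) (if k == n.-1 :> nat then a else (i == k.+1)%:R) * h k
    = (if i is i'.+1 then h i' else 0) + a * h n.-1.
Proof.
case: n => // n lt_in; rewrite big_ord_recr /= eqxx; congr (_ + _).
rewrite (eq_bigr (fun k : 'I_n => if i == k.+1 then h k else 0)); last first.
  by move=> k _; rewrite ltn_eqF //; case: eqP; rewrite ?mul1r ?mul0r.
rewrite -big_mkcond; case: i lt_in => [|i] lt_in; first by rewrite big_pred0.
by rewrite (big_pred1 (@Ordinal n i lt_in)).
Qed.

Lemma sum_shift_col n j (a : F) (h : nat -> F) : (j < n)%N ->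
  \sum_(k < n) h k * (if k == n.-1 :> nat then a else (j == k.+1)%:R)
    = (if j is j'.+1 then h j' else 0) + h n.-1 * a.
Proof.
case: n => // n lt_jn; rewrite big_ord_recr /= eqxx; congr (_ + _).
rewrite (eq_bigr (fun k : 'I_n => if j == k.+1 then h k else 0)); last first.
  by move=> k _; rewrite ltn_eqF //; case: eqP; rewrite ?mulr1 ?mulr0.
rewrite -big_mkcond; case: j lt_jn => [|j] lt_jn; first by rewrite big_pred0.
by rewrite (big_pred1 (@Ordinal n j lt_jn)).
Qed.

(** Both products have entry p_(i+j) for i, j > 0, entry -p_0 at the corner, and 0 elsewhere on the
    first row and column. In every product of entries one factor is 0 or 1, so noncommuting
    coefficients never meet. *)
Lemma left_companionmx_symmetrizer (p : {poly F}) : p \is monic ->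
  left_companionmx p *m symmetrizer p = symmetrizer p *m right_companionmx p.
Proof.
move=> p_mon; apply/matrixP => i j.
have n_gt0 : (0 < (size p).-1)%N by apply: leq_ltn_trans (ltn_ord i).
(* By symmetry, both the last row and the last column of the symmetrizer are (1, 0, ..., 0). *)
have last k : p`_((size p).-2 + k).+1 = (k == 0)%:R.
  rewrite -addSn prednK //; case: k => [|k]; first by rewrite addn0; exact/monicP.
  by rewrite nth_default // addnS -addSn (leq_trans (leqSpred _)) ?leq_addr.
have -> : (left_companionmx p *m symmetrizer p) i j =
    (if (i : nat) is i'.+1 then p`_(i' + j).+1 else 0 : F) - p`_i * (j == 0 :> nat)%:R.
  rewrite -last -mulNr -(sum_shift_row _ (fun k => p`_(k + j).+1)) // mxE.
  by apply: eq_bigr => k _; rewrite !mxE.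
have -> : (symmetrizer p *m right_companionmx p) i j =
    (if (j : nat) is j'.+1 then p`_(i + j').+1 else 0 : F) - (i == 0 :> nat)%:R * p`_j.
  rewrite -last addnC -mulrN -(sum_shift_col _ (fun k => p`_(i + k).+1)) // mxE.
  by apply: eq_bigr => k _; rewrite !mxE.
case: (nat_of_ord i) (nat_of_ord j) => [|k] [|l] //=.
- by rewrite mulr1 mul1r.
- by rewrite mulr0 mul1r add0n subr0 subrr.
- by rewrite mulr1 mul0r addn0 subr0 subrr.
- by rewrite mulr0 mul0r !subr0 addSn addnS.
Qed.

Lemma right_left_companionmx_similar (p : {poly F}) :
  p \is monic -> mx_similar (right_companionmx p) (left_companionmx p).
Proof.
move=> p_mon; have [S HS] := symmetrizer_invertible p_mon.
exact: mx_similarP HS (esym (left_companionmx_symmetrizer p_mon)).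
Qed.

End Companion.

(** * One-sided ideals of polynomials and their monic generators *)

Section MinimalPolynomials.

Variable F : unitRingType.

Lemma sum_coef_widen (V : nmodType) (G : nat -> F -> V) (p : {poly F}) N :
  (forall j, G j 0 = 0) -> (size p <= N)%N ->
  \sum_(j < size p) G j p`_j = \sum_(j < N) G j p`_j.
Proof.
move=> G0 le_pN; rewrite (big_ord_widen N (fun j => G j p`_j)) // big_mkcond.
by apply: eq_bigr => j _; case: ltnP => // /(nth_default 0) ->; rewrite G0.
Qed.

(* Division with the quotient on the right; the library has only the one with
   the quotient on the left. *)
Lemma monic_right_division (p q : {poly F}) : p \is monic ->
  exists r s : {poly F}, q = p * r + s /\ (size s < size p)%N.
Proof.
move=> p_mon; elim/poly_ind: q => [|q c [r [s [-> lt_s]]]].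
  by exists 0, 0; rewrite mulr0 addr0 size_poly0 size_poly_gt0 monic_neq0.
(* The new remainder candidate [t] may reach the degree of [p]; as [p] is monic, subtracting
   [p * a%:P] cancels its coefficient [a] there. *)
set t := s * 'X + c%:P; set a := t`_(size p).-1.
exists (r * 'X + a%:P), (t - p * a%:P); split.
  by rewrite mulrDr mulrDl -[LHS]addrA -[RHS]addrA mulrA (addrC (p * a%:P)) subrK.
have sp : (0 < size p)%N by rewrite size_poly_gt0 monic_neq0.
rewrite -(prednK sp) ltnS; apply/leq_sizeP => j.
rewrite leq_eqVlt => /predU1P[<-|lt_j]; rewrite coefB coefMC.
  by rewrite -lead_coefE (monicP p_mon) mul1r subrr.
rewrite (prednK sp) in lt_j; rewrite (nth_default _ lt_j) mul0r subr0.
rewrite nth_default // (leq_trans _ lt_j) //.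
by rewrite size_MXaddC; case: ifP.
Qed.

(** Division by [p] leaves a remainder in [I] that is too small to be nonzero, so [p] generates [I]
    and [xget] does not fall back on its default. The sizes of [f] and [p] agree by minimality of
    [p] one way and by p = f * r the other, so uniqueness of the generator need not be proved. *)
Lemma monic_right_generatorP (I : classical_sets.set {poly F}) (p : {poly F}) :
  p \is monic -> I p ->
  (forall q r, I q -> I r -> I (q - r)) -> (forall q r, I q -> I (q * r)) ->
  (forall q, I q -> (size q < size p)%N -> q = 0) ->
  let f := classical_sets.xget 0 (monic_right_generator I) in
  [/\ f \is monic, size f = size p & I f].
Proof.
move=> p_mon Ip IB IM I0 f.
have [f_mon genf] : monic_right_generator I f.
  apply: classical_sets.xgetPex; exists p.
  split=> // q; split=> [Iq|[r ->]]; last exact: IM.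
  have [r [s [qE lt_s]]] := monic_right_division q p_mon; exists r.
  rewrite qE (I0 s) ?addr0 //.
  by rewrite -(addKr (p * r) s) addrC -qE; apply/IB/IM.
have If : I f by apply/genf; exists 1; rewrite mulr1.
split=> //; apply/eqP; rewrite eqn_leq andbC leqNgt; apply/andP; split.
  by apply/negP=> /(I0 _ If)/eqP; rewrite (negPf (monic_neq0 f_mon)).
have [r pE] := (genf p).1 Ip.
have rn0 : r != 0.
  by apply: contra_eq_neq pE => ->; rewrite mulr0 monic_neq0.
by rewrite pE size_monicM // -subn1 -addnBA ?leq_addr // size_poly_gt0.
Qed.

Lemma monic_left_generatorP (I : classical_sets.set {poly F}) (p : {poly F}) :
  p \is monic -> I p ->
  (forall q r, I q -> I r -> I (q - r)) -> (forall q r, I q -> I (r * q)) ->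
  (forall q, I q -> (size q < size p)%N -> q = 0) ->
  let f := classical_sets.xget 0 (monic_left_generator I) in
  [/\ f \is monic, size f = size p & I f].
Proof.
move=> p_mon Ip IB IM I0 f.
have [f_mon genf] : monic_left_generator I f.
  apply: classical_sets.xgetPex; exists p.
  split=> // q; split=> [Iq|[r ->]]; last exact: IM.
  have qE := Pdiv.RingMonic.rdivp_eq p_mon q.
  move: (Pdiv.Ring.ltn_rmodpN0 q (monic_neq0 p_mon)) qE.
  set r := Pdiv.CommonRing.rdivp q p; set s := Pdiv.CommonRing.rmodp q p.
  move=> lt_s qE; exists r; rewrite qE (I0 s) ?addr0 //.
  by rewrite -(addKr (r * p) s) addrC -qE; apply/IB/IM.
have If : I f by apply/genf; exists 1; rewrite mul1r.
split=> //; apply/eqP; rewrite eqn_leq andbC leqNgt; apply/andP; split.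
  by apply/negP=> /(I0 _ If)/eqP; rewrite (negPf (monic_neq0 f_mon)).
have [r pE] := (genf p).1 Ip.
have rn0 : r != 0.
  by apply: contra_eq_neq pE => ->; rewrite mul0r monic_neq0.
rewrite pE size_Mmonic // addnC -subn1 -addnBA ?leq_addr //.
by rewrite size_poly_gt0.
Qed.

(** * Controllable pairs *)

Section Columns.

Variables (n : nat) (A : 'M[F]_n) (v : 'cV[F]_n).

(** By conversion, [right_annihilator A v] is the zero set of this map. *)
Definition col_eval (q : {poly F}) : 'cV[F]_n :=
  \sum_(j < size q) A ^+ j *m v *m (q`_j)%:M.

Definition controllability_mx : 'M[F]_n :=
  \matrix_(i, j) (A ^+ j *m v) i ord0.

Lemma col_evalE N (q : {poly F}) : (size q <= N)%N ->
  col_eval q = \sum_(j < N) A ^+ j *m v *m (q`_j)%:M.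
Proof.
pose G j (a : F) := A ^+ j *m v *m a%:M.
by apply: (@sum_coef_widen _ G) => j; rewrite /G raddf0 mulmx0.
Qed.

Lemma col_evalB (q r : {poly F}) : col_eval (q - r) = col_eval q - col_eval r.
Proof.
have le_max := leq_trans (size_polyD q (- r)).
pose N := maxn (size q) (size r).
rewrite !(@col_evalE N) ?leq_maxl ?leq_maxr //; last first.
  by apply: le_max; rewrite size_polyN.
rewrite -sumrB; apply: eq_bigr => j _.
by rewrite coefB raddfB mulmxBr.
Qed.

Lemma col_evalMX (q : {poly F}) : col_eval (q * 'X) = A *m col_eval q.
Proof.
rewrite (@col_evalE (size q).+1); last first.
  by rewrite (leq_trans (size_polyMleq _ _)) // size_polyX addn2.
rewrite big_ord_recl coefMX /= raddf0 mulmx0 add0r mulmx_sumr.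
by apply: eq_bigr => j _; rewrite coefMX /= exprS -!mulmxE !mulmxA.
Qed.

Lemma col_evalMC (q : {poly F}) c :
  col_eval (q * c%:P) = col_eval q *m c%:M.
Proof.
rewrite (@col_evalE (size q)) ?mulmx_suml; last first.
  by apply/leq_sizeP=> j /(nth_default 0) qj; rewrite coefMC qj mul0r.
by apply: eq_bigr => j _; rewrite coefMC scalar_mxM mulmxA.
Qed.

(** Evaluation is not multiplicative in general, but right multiplication by 'X applies [A] to the
    value and by a constant scales it on the right; both preserve 0. *)
Lemma col_evalM_eq0 (q r : {poly F}) : col_eval q = 0 -> col_eval (q * r) = 0.
Proof.
move=> q0; elim/poly_ind: r => [|r c IHr].
  by rewrite mulr0 -(subrr 0) col_evalB subrr.
rewrite mulrDr -[q * c%:P]opprK col_evalB mulrA col_evalMX IHr mulmx0 sub0r.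
by rewrite -mulrN -polyCN col_evalMC q0 mul0mx oppr0.
Qed.

Lemma col_eval_small (q : {poly F}) : (size q <= n)%N ->
  col_eval q = controllability_mx *m \col_j q`_j.
Proof.
move=> le_q; rewrite (col_evalE le_q); apply/matrixP=> i k.
rewrite ord1 summxE mxE; apply: eq_bigr => j _.
by rewrite !mxE big_ord1 !mxE mulr1n.
Qed.

Lemma col_evalXn : col_eval 'X^n = A ^+ n *m v.
Proof.
rewrite (@col_evalE n.+1) ?size_polyXn // big_ord_recr big1 => [|j _].
  by rewrite /= coefXn eqxx mulmx1 add0r.
by rewrite coefXn ltn_eqF //= raddf0 mulmx0.
Qed.

Lemma minpoly_colP : controllable A v ->
  [/\ minpoly_col A v \is monic, size (minpoly_col A v) = n.+1
    & col_eval (minpoly_col A v) = 0].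
Proof.
case=> W [VW WV]; pose c := W *m (A ^+ n *m v).
pose q := \poly_(j < n) (if insub j is Some i then c i ord0 else 0).
have q_n : (size q <= n)%N by exact: size_poly.
have q_lt : (size (- q) < size ('X^n : {poly F})%R)%N.
  by rewrite size_polyN size_polyXn ltnS.
have small0 r : col_eval r = 0 -> (size r <= n)%N -> r = 0.
  move=> r0 le_r; have /(congr1 (mulmx W)) := r0.
  rewrite col_eval_small // mulmxA WV mul1mx mulmx0 => /matrixP rE.
  apply/polyP=> j; rewrite coef0; case: (ltnP j n) => [lt_j|le_j].
    by have := rE (Ordinal lt_j) ord0; rewrite !mxE.
  by rewrite nth_default // (leq_trans le_r).
pose p := 'X^n - q.
have p_size : size p = n.+1 by rewrite size_polyDl // size_polyXn.
have p_mon : p \is monic.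
  by rewrite monicE lead_coefDl // lead_coefXn.
have p0 : col_eval p = 0.
  rewrite col_evalB col_evalXn col_eval_small //.
  rewrite (_ : (\col_j q`_j) = c) ?mulmxA ?VW ?mul1mx ?subrr //.
  apply/matrixP=> i k; rewrite ord1 mxE coef_poly ltn_ord.
  by rewrite valK.
rewrite -p_size; apply: monic_right_generatorP => //.
- move=> r s r0 s0; change (col_eval (r - s) = 0).
  by rewrite col_evalB [X in X - _]r0 [X in _ - X]s0 subrr.
- by move=> r s; apply: col_evalM_eq0.
- by move=> r r0; rewrite p_size ltnS; apply: small0.
Qed.

End Columns.

(** [A] sends each column A^j v to the next one. Past the last column, the relation f0, with [f]
    monic, rewrites A^n v through the lower powers. Sizing [A] by [f] avoids casts. *)
Lemma controllability_companion (f : {poly F})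
    (A : 'M[F]_((size f).-1)) (v : 'cV[F]_((size f).-1)) :
  f \is monic -> col_eval A v f = 0 ->
  A *m controllability_mx A v = controllability_mx A v *m left_companionmx f.
Proof.
move=> f_mon f0; apply/matrixP=> i j.
have n_gt0 : (0 < (size f).-1)%N by apply: leq_ltn_trans (ltn_ord i).
have AVE : (A *m controllability_mx A v) i j = (A ^+ j.+1 *m v) i ord0.
  rewrite exprS -mulmxE -mulmxA !mxE.
  by apply: eq_bigr => k _; rewrite !mxE.
rewrite {}AVE [RHS]mxE; under [RHS]eq_bigr do rewrite
  [controllability_mx _ _ _ _]mxE [left_companionmx _ _ _]mxE.
case: eqP => [jE|/eqP ne_j].
  have /matrixP/(_ i ord0) := f0; rewrite (@col_evalE _ _ _ (size f).-1.+1); last first.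
    exact: leqSpred.
  rewrite big_ord_recr /= -lead_coefE (monicP f_mon) mulmx1 !mxE addrC.
  move/eqP; rewrite addr_eq0 jE prednK // summxE => /eqP ->.
  rewrite -sumrN; apply: eq_bigr => k _.
  by rewrite !mxE big_ord1 !mxE mulr1n mulrN.
have lt_j : (j.+1 < (size f).-1)%N.
  by rewrite ltn_neqAle -[X in _ != X](prednK n_gt0) eqSS ne_j /=.
rewrite (bigD1 (Ordinal lt_j)) //= eqxx mulr1 big1 ?addr0 // => k.
by rewrite -val_eqE /= => /negPf ->; rewrite mulr0.
Qed.

Lemma controllable_similar n (A : 'M[F]_n) (v : 'cV[F]_n) : controllable A v ->
  mx_similar A (left_companionmx (minpoly_col A v)).
Proof.
move=> ctrl; have [] := minpoly_colP ctrl; case: ctrl => W [VW WV].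
(* With [f] abstracted from [A] and [v], the size [n] can be replaced by [(size f).-1]
   throughout. *)
move: (minpoly_col A v) => f f_mon f_size f0.
have nE : (size f).-1 = n by rewrite f_size.
move: A v W VW WV f0; clear f_size; case: n / nE => A v W VW WV f0.
apply: mx_similar_sym; apply: (@mx_similarP _ _ _ _ (controllability_mx A v) W).
  by split.
by rewrite controllability_companion.
Qed.

(** * Observable pairs *)

Section Rows.

Variables (n : nat) (u : 'rV[F]_n) (A : 'M[F]_n).

Definition row_eval (q : {poly F}) : 'rV[F]_n :=
  \sum_(j < size q) q`_j *: (u *m A ^+ j).

Definition observability_mx : 'M[F]_n :=
  \matrix_(i, j) (u *m A ^+ i) ord0 j.

Lemma row_evalE N (q : {poly F}) : (size q <= N)%N ->
  row_eval q = \sum_(j < N) q`_j *: (u *m A ^+ j).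
Proof.
pose G j (a : F) := a *: (u *m A ^+ j).
by apply: (@sum_coef_widen _ G) => j; rewrite /G scale0r.
Qed.

Lemma row_evalB (q r : {poly F}) : row_eval (q - r) = row_eval q - row_eval r.
Proof.
have le_max := leq_trans (size_polyD q (- r)).
pose N := maxn (size q) (size r).
rewrite !(@row_evalE N) ?leq_maxl ?leq_maxr //; last first.
  by apply: le_max; rewrite size_polyN.
by rewrite -sumrB; apply: eq_bigr => j _; rewrite coefB scalerBl.
Qed.

Lemma row_evalMX (q : {poly F}) : row_eval (q * 'X) = row_eval q *m A.
Proof.
rewrite (@row_evalE (size q).+1); last first.
  by rewrite (leq_trans (size_polyMleq _ _)) // size_polyX addn2.
rewrite big_ord_recl coefMX /= scale0r add0r mulmx_suml.
by apply: eq_bigr => j _; rewrite coefMX /= exprSr -mulmxE mulmxA scalemxAl.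
Qed.

Lemma row_evalCM (q : {poly F}) c : row_eval (c%:P * q) = c *: row_eval q.
Proof.
rewrite (@row_evalE (size q)) ?scaler_sumr; last first.
  by apply/leq_sizeP=> j /(nth_default 0) qj; rewrite coefCM qj mulr0.
by apply: eq_bigr => j _; rewrite coefCM scalerA.
Qed.

(** As 'X is central, (r 'X + c) q = (r q) 'X + c q; the first term applies [A] on the right, the
    second scales on the left. *)
Lemma row_evalM_eq0 (q r : {poly F}) : row_eval q = 0 -> row_eval (r * q) = 0.
Proof.
move=> q0; elim/poly_ind: r => [|r c IHr].
  by rewrite mul0r -(subrr 0) row_evalB subrr.
rewrite mulrDl -[c%:P * q]opprK row_evalB -mulrA -commr_polyX mulrA row_evalMX.
by rewrite IHr mul0mx sub0r -mulNr -polyCN row_evalCM q0 scaler0 oppr0.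
Qed.

Lemma row_eval_small (q : {poly F}) : (size q <= n)%N ->
  row_eval q = (\row_j q`_j) *m observability_mx.
Proof.
move=> le_q; rewrite (row_evalE le_q); apply/matrixP=> i k.
by rewrite ord1 summxE mxE; apply: eq_bigr => j _; rewrite !mxE.
Qed.

Lemma row_evalXn : row_eval 'X^n = u *m A ^+ n.
Proof.
rewrite (@row_evalE n.+1) ?size_polyXn // big_ord_recr big1 => [|j _].
  by rewrite /= coefXn eqxx scale1r add0r.
by rewrite coefXn ltn_eqF //= scale0r.
Qed.

Lemma minpoly_rowP : observable u A ->
  [/\ minpoly_row u A \is monic, size (minpoly_row u A) = n.+1
    & row_eval (minpoly_row u A) = 0].
Proof.
(* Dually, [c] holds the coordinates of u A^n in the basis u, u A, ..., u A^(n-1). *)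
case=> W [UW WU]; pose c := u *m A ^+ n *m W.
pose q := \poly_(j < n) (if insub j is Some i then c ord0 i else 0).
have q_n : (size q <= n)%N by exact: size_poly.
have q_lt : (size (- q) < size ('X^n : {poly F})%R)%N.
  by rewrite size_polyN size_polyXn ltnS.
have small0 r : row_eval r = 0 -> (size r <= n)%N -> r = 0.
  move=> r0 le_r; have /(congr1 (mulmxr W)) := r0.
  rewrite /= row_eval_small // -mulmxA UW mulmx1 mul0mx => /matrixP rE.
  apply/polyP=> j; rewrite coef0; case: (ltnP j n) => [lt_j|le_j].
    by have := rE ord0 (Ordinal lt_j); rewrite !mxE.
  by rewrite nth_default // (leq_trans le_r).
pose p := 'X^n - q.
have p_size : size p = n.+1 by rewrite size_polyDl // size_polyXn.
have p_mon : p \is monic.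
  by rewrite monicE lead_coefDl // lead_coefXn.
have p0 : row_eval p = 0.
  rewrite row_evalB row_evalXn row_eval_small //.
  rewrite (_ : (\row_j q`_j) = c) -?mulmxA ?WU ?mulmx1 ?subrr //.
  apply/matrixP=> i k; rewrite ord1 mxE coef_poly ltn_ord.
  by rewrite valK.
rewrite -p_size; apply: monic_left_generatorP => //.
- move=> r s r0 s0; change (row_eval (r - s) = 0).
  by rewrite row_evalB [X in X - _]r0 [X in _ - X]s0 subrr.
- by move=> r s; apply: row_evalM_eq0.
- by move=> r r0; rewrite p_size ltnS; apply: small0.
Qed.

End Rows.

Lemma observability_companion (f : {poly F})
    (u : 'rV[F]_((size f).-1)) (A : 'M[F]_((size f).-1)) :
  f \is monic -> row_eval u A f = 0 ->
  observability_mx u A *m A = right_companionmx f *m observability_mx u A.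
Proof.
move=> f_mon f0; apply/matrixP=> i j.
have n_gt0 : (0 < (size f).-1)%N by apply: leq_ltn_trans (ltn_ord i).
have UAE : (observability_mx u A *m A) i j = (u *m A ^+ i.+1) ord0 j.
  rewrite exprSr -mulmxE mulmxA !mxE.
  by apply: eq_bigr => k _; rewrite !mxE.
rewrite {}UAE [RHS]mxE; under [RHS]eq_bigr do rewrite
  [observability_mx _ _ _ _]mxE [right_companionmx _ _ _]mxE.
case: eqP => [iE|/eqP ne_i].
  have /matrixP/(_ ord0 j) := f0.
  rewrite (@row_evalE _ _ _ (size f).-1.+1) ?leqSpred //.
  rewrite big_ord_recr /= -lead_coefE (monicP f_mon) scale1r !mxE addrC.
  move/eqP; rewrite addr_eq0 iE prednK // summxE => /eqP ->.
  by rewrite -sumrN; apply: eq_bigr => k _; rewrite !mxE mulNr.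
have lt_i : (i.+1 < (size f).-1)%N.
  by rewrite ltn_neqAle -[X in _ != X](prednK n_gt0) eqSS ne_i /=.
rewrite (bigD1 (Ordinal lt_i)) //= eqxx mul1r big1 ?addr0 // => k.
by rewrite -val_eqE /= => /negPf ->; rewrite mul0r.
Qed.

(** The observability matrix conjugates [A] to the right companion matrix; the symmetrizer then
    leads to the left one, in terms of which [poly_similar] is defined. *)
Lemma observable_similar n (u : 'rV[F]_n) (A : 'M[F]_n) : observable u A ->
  mx_similar A (left_companionmx (minpoly_row u A)).
Proof.
move=> obs; have [] := minpoly_rowP obs; case: obs => W [UW WU].
move: (minpoly_row u A) => f f_mon f_size f0.
have nE : (size f).-1 = n by rewrite f_size.
move: A u W UW WU f0; clear f_size; case: n / nE => A u W UW WU f0.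
apply: mx_similar_trans (right_left_companionmx_similar f_mon).
apply: (@mx_similarP _ _ _ _ (observability_mx u A) W); first by split.
exact: observability_companion.
Qed.

End MinimalPolynomials.

(** * Transfer of similarity from companion matrices to the pairs *)

Theorem proposition4p3 (F : unitRingType) (divF : division_ring F) :
  (forall (n n' : nat) (A : 'M[F]_n) (v : 'cV[F]_n)
          (A' : 'M[F]_n') (v' : 'cV[F]_n'),
     controllable A v -> controllable A' v' ->
     (poly_similar (minpoly_col A v) (minpoly_col A' v') <-> mx_similar A A'))
  /\
  (forall (n n' : nat) (u : 'rV[F]_n) (A : 'M[F]_n)
          (u' : 'rV[F]_n') (A' : 'M[F]_n'),
     observable u A -> observable u' A' ->
     (poly_similar (minpoly_row u A) (minpoly_row u' A') <-> mx_similar A A')).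
Proof.
(* Similarity is an equivalence relation, so each matrix may be replaced by its companion form. *)
have conj m m' n n' (A : 'M[F]_m) (A' : 'M[F]_m') (C : 'M[F]_n) (C' : 'M[F]_n') :
    mx_similar A C -> mx_similar A' C' -> (mx_similar C C' <-> mx_similar A A').
  move=> AC AC'; split=> [CC|AA].
    exact: mx_similar_trans AC (mx_similar_trans CC (mx_similar_sym AC')).
  exact: mx_similar_trans (mx_similar_sym AC) (mx_similar_trans AA AC').
split=> [n n' A v A' v' c c'|n n' u A u' A' o o'].
  have [[f_mon _ _] [g_mon _ _]] := (minpoly_colP c, minpoly_colP c').
  have e := conj _ _ _ _ _ _ _ _ (controllable_similar c) (controllable_similar c').
  by split=> [[_ _ /e]|/e].
have [[f_mon _ _] [g_mon _ _]] := (minpoly_rowP o, minpoly_rowP o').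
have e := conj _ _ _ _ _ _ _ _ (observable_similar o) (observable_similar o').
by split=> [[_ _ /e]|/e].
Qed.
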